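(* Let $\mathcal{X}$ be a finite set, let $\mathcal{C}$ be a (nonempty) concept class over $\mathcal{X}$, and let $d:\mathcal{X}\times\mathcal{X}\rightarrow\mathbb{R}^{\ge 0}$ be any function. Then $$\mathcal{S}_{\mathrm{CS}^{d}_{\min}}(\mathcal{C}) \;\geq\; \lceil \mathrm{SD}(\mathcal{C})/2\rceil .$$
   Context: A concept over a set $\mathcal{X}$ is a subset of $\mathcal{X}$, identified with its indicator function $\mathcal{X}\to\{0,1\}$; a concept class is a set of concepts. Minimum distance model. For $d:\mathcal{X}\times\mathcal{X}\to\mathbb{R}^{\ge 0}$, $x\in\mathcal{X}$ and a concept $C$, let $\mathrm{CS}^d_{\min}(x,C)$ be the set of all $x'\in\mathcal{X}$ with $C(x')\ne C(x)$ that minimize $d(x,x')$ among all points of $\mathcal{X}$ whose label differs from $C(x)$ (empty if no such point exists). Learning with contrast sets. Let $\mathrm{CS}$ assign to each pair $(x,C)$ a subset of $\mathcal{X}$. A deterministic learner, who knows $\mathcal{C}$ and $\mathrm{CS}$, tries to identify an unknown $C^*\in\mathcal{C}$. The initial version space is $\mathcal{C}_1=\mathcal{C}$. In round $i\ge1$ the learner, depending on all previous queries and responses, chooses $x_i\in\mathcal{X}$. The oracle returns $y_i=C^*(x_i)$ and, if $\mathrm{CS}(x_i,C^* )\neq\emptyset$, a pair $(x_i',y_i')$ where $x'_i\in\mathrm{CS}(x_i,C^* )$ is chosen adversarially and $y'_i=C^*(x_i')$; if $\mathrm{CS}(x_i,C^* )=\emptyset$ it returns $y_i$ and a dummy symbol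 $\omega$. The new version space $\mathcal{C}_{i+1}$ consists of all $C\in\mathcal{C}_i$ with $C(x_i)=y_i$ and, if $\omega$ was returned, $\mathrm{CS}(x_i,C)=\emptyset$, and otherwise $C(x'_i)=y'_i$ and $x'_i\in\mathrm{CS}(x_i,C)$. The target is identified after $n$ rounds if $\mathcal{C}_{n+1}=\{C^*\}$. $\mathcal{S}_{\mathrm{CS}}(\mathcal{C})$ is the infimum over learners of the supremum, over $C^*\in\mathcal{C}$ and all admissible oracle choices, of the number of rounds until the target is identified ($0$ if $|\mathcal{C}|=1$; $\infty$ if it is never identified). Self-directed learning. For finite $\mathcal{X}$ with $|\mathcal{X}|=n$, a self-directed learner for $\mathcal{C}$ works in $n$ rounds. In each round it selects (adaptively) a not previously selected instance $x\in\mathcal{X}$ and predicts a label $b\in\{0,1\}$ for it; then it is told $C^*(x)$, where $C^*\in\mathcal{C}$ is the unknown target, and it incurs a mistake if $b\neq C^*(x)$. Its cost on $C^*$ is the total number of mistakes in the $n$ rounds; its cost on $\mathcal{C}$ is the maximum of its costs on concepts in $\mathcal{C}$. $\mathrm{SD}(\mathcal{C})$ is the smallest cost on $\mathcal{C}$ of any self-directed learner for $\mathcal{C}$. *)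

(* Defs.v *)
From mathcomp Require Import all_boot all_order all_algebra.
From mathcomp Require Import boolp classical_sets reals ereal.

Set Implicit Arguments.
Unset Strict Implicit.
Unset Printing Implicit Defensive.

Import Order.TTheory GRing.Theory Num.Theory.

(* A concept over a finite type X is a set [c : {set X}]; the label that it
   gives to x is the boolean [x \in c].  A concept class is a
   [C : {set {set X}}]. *)

Definition contrast_map (X : finType) := X -> {set X} -> {set X}.

Definition CSmin (R : realType) (X : finType) (d : X -> X -> R) :
    contrast_map X := fun x c =>
  [set x' : X | ((x' \in c) != (x \in c)) &&
     [forall z : X, ((z \in c) != (x \in c)) ==> (d x x' <= d x z)%R]]%SET.

(* An answer (y, Some (x', y')) carries a contrastive example, (y, None) is
   y together with the dummy symbol. *)
Definition answer (X : Type) := (bool * option (X * bool))%type.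

(* The answers an oracle may give to the query x when the target is c.  A
   concept survives a round exactly when the answer received is one that could
   have been given with that concept as the target. *)
Definition admissible (X : finType) (CS : contrast_map X) (c : {set X})
    (x : X) (a : answer X) : bool :=
  (a.1 == (x \in c)) &&
  match a.2 with
  | None => CS x c == finset.set0
  | Some (x', y') => (x' \in CS x c) && (y' == (x' \in c))
  end.

(* The rounds played so far, earliest first. *)
Definition history (X : Type) := seq (X * answer X).

Definition learner (X : Type) := history X -> X.

(* The first n rounds of learner L when round i (counted from 0) is answered
   by [a i]. *)
Fixpoint transcript (X : Type) (L : learner X) (a : nat -> answer X)
    (n : nat) : history X :=
  if n is m.+1 then
    let h := transcript L a m in rcons h (L h, a m)
  else [::].

Definition version_space (X : finType) (CS : contrast_map X)
    (C : {set {set X}}) (h : history X) : {set {set X}} :=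
  foldl (fun (V : {set {set X}}) (q : X * answer X) =>
           [set c in V | admissible CS c q.1 q.2]%SET)
        C h.

Definition legal_answers (X : finType) (CS : contrast_map X) (L : learner X)
    (c : {set X}) (a : nat -> answer X) : Prop :=
  forall i : nat, admissible CS c (L (transcript L a i)) (a i).

(* Equal to +oo if the target is never identified. *)
Definition rounds (R : realType) (X : finType) (CS : contrast_map X)
    (C : {set {set X}}) (L : learner X) (c : {set X}) (a : nat -> answer X) :
    \bar R :=
  ereal_inf [set (n%:R)%:E | n in
    [set n : nat | version_space CS C (transcript L a n) = [set c]%SET]]%classic.

Definition learner_cost (R : realType) (X : finType) (CS : contrast_map X)
    (C : {set {set X}}) (L : learner X) : \bar R :=
  ereal_sup [set rounds R CS C L p.1 p.2 | p in
    [set p : {set X} * (nat -> answer X) |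
       p.1 \in C /\ legal_answers CS L p.1 p.2]]%classic.

(* The case of a singleton class only matters when X is empty: there are then
   no learners, and the infimum would be +oo. *)
Definition contrast_complexity (R : realType) (X : finType)
    (CS : contrast_map X) (C : {set {set X}}) : \bar R :=
  if #|C| == 1 then 0%E
  else ereal_inf [set learner_cost R CS C L | L in setT]%classic.

(* A self-directed learner as a decision tree: [Ask x b k] selects x, predicts
   b, and goes on as [k y] once told the true label y. *)
Inductive sd_learner (X : Type) : Type :=
| Done
| Ask of X & bool & (bool -> sd_learner X).
Arguments Done {X}.

(* Every branch selects each element of S exactly once, and nothing else. *)
Fixpoint sd_valid (X : finType) (S : {set X}) (T : sd_learner X) : Prop :=
  match T with
  | Done => S = finset.set0
  | Ask x _ k => x \in S /\ forall y : bool, sd_valid (S :\ x) (k y)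
  end.

Fixpoint sd_mistakes (X : finType) (T : sd_learner X) (c : {set X}) : nat :=
  match T with
  | Done => 0
  | Ask x b k => (b != (x \in c)) + sd_mistakes (k (x \in c)) c
  end.

Definition sd_cost (X : finType) (C : {set {set X}}) (T : sd_learner X) : nat :=
  \max_(c in C) sd_mistakes T c.

Definition sd_achievable (X : finType) (C : {set {set X}}) (m : nat) : Prop :=
  exists T : sd_learner X, sd_valid [set: X]%SET T /\ sd_cost C T = m.

Lemma sd_valid_exists (X : finType) (S : {set X}) :
  exists T : sd_learner X, sd_valid S T.
Proof.
have [n] := ubnP #|S|; elim: n S => // n IHn S ltSn.
have [->|[x xS]] := set_0Vmem S; first by exists Done.
have [|T validT] := IHn (S :\ x); first by move: ltSn; rewrite (cardsD1 x) xS.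
by exists (Ask x true (fun=> T)).
Qed.

Lemma sd_achievable_exists (X : finType) (C : {set {set X}}) :
  exists m : nat, `[< sd_achievable C m >].
Proof.
have [T validT] := sd_valid_exists [set: X]%SET.
by exists (sd_cost C T); apply/asboolP; exists T.
Qed.

Definition SD (X : finType) (C : {set {set X}}) : nat :=
  ex_minn (sd_achievable_exists C).

(* Main.v *)
Require Import Defs.
From mathcomp Require Import all_boot all_order all_algebra.
From mathcomp Require Import boolp classical_sets reals ereal.

(** A self-directed learner can simulate a contrast-set learner at the price of
    two mistakes per round.  To answer a query x it first selects x itself (at
    most one mistake), which reveals the label y, and then selects the other
    points by increasing distance from x, predicting y each time: the first
    mistake exhibits a closest point with the opposite label.  Points whose
    labels are already known are skipped.  Once the version space is a
    singleton, no further mistake is made. *)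

Set Implicit Arguments.
Unset Strict Implicit.
Unset Printing Implicit Defensive.

Import Order.TTheory GRing.Theory Num.Theory.

Section SelfDirected.
Variable X : finType.
Implicit Types (x : X) (c : {set X}) (S : {set X}) (V : {set {set X}}).

(** [S] holds the points not yet selected and [V] the concepts still possible; labels outside [S]
    are already revealed. *)
Definition agree_outside S V : Prop :=
  {in V &, forall c c' x, x \notin S -> (x \in c) = (x \in c')}.

(** The budget [f] may depend on the target, since the simulated history does. *)
Definition sd_within S V (f : {set X} -> nat) : Prop :=
  exists2 T, sd_valid S T & {in V, forall c, sd_mistakes T c <= f c}.

Lemma agree_outside_sub S V V' :
  V' \subset V -> agree_outside S V -> agree_outside S V'.
Proof.
by move=> /fintype.subsetP sub agS c c' /sub cV /sub c'V; apply: agS.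
Qed.

Lemma sd_within_le S V f g :
  {in V, forall c, f c <= g c} -> sd_within S V f -> sd_within S V g.
Proof.
move=> le_fg [T vT mT]; exists T => // c cV.
exact: leq_trans (mT c cV) (le_fg c cV).
Qed.

Lemma sd_mistakes_le_card S (T : sd_learner X) c :
  sd_valid S T -> sd_mistakes T c <= #|S|.
Proof.
elim: T S => [|x b k IH] S //= [xS vk].
by rewrite (cardsD1 x S) xS leq_add ?leq_b1 // IH.
Qed.

Lemma sd_within_card S V : sd_within S V (fun=> #|X|).
Proof.
have [T vT] := sd_valid_exists S; exists T => // c _.
by rewrite (leq_trans (sd_mistakes_le_card c vT)) // max_card.
Qed.

Lemma sd_within_known S V c0 : V \subset [set c0] -> sd_within S V (fun=> 0).
Proof.
move=> /fintype.subsetP sub.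
suff [T vT mT] : exists2 T, sd_valid S T & sd_mistakes T c0 = 0.
  by exists T => // c /sub; rewrite inE => /eqP ->; rewrite mT.
have [T] := sd_valid_exists S.
elim: T S => [|x b k IH] S /=; first by exists Done.
case=> xS vk; have [T vT mT] := IH (x \in c0) _ (vk _).
by exists (Ask x (x \in c0) (fun=> T)); rewrite /= ?eqxx.
Qed.

Lemma sd_within_ask x b S V f :
  agree_outside S V ->
  (forall y V', V' \subset V -> agree_outside (S :\ x) V' ->
     {in V', forall c, (x \in c) = y} ->
     sd_within (S :\ x) V' (fun c => f c - (b != y))) ->
  {in V, forall c, (b != (x \in c)) <= f c} ->
  sd_within S V f.
Proof.
move=> agS askx f_ge.
pose Vy y := [set c in V | (x \in c) == y].
have subV y : Vy y \subset V.
  by apply/fintype.subsetP => c; rewrite inE => /andP[].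
have labV y : {in Vy y, forall c, (x \in c) = y}.
  by move=> c; rewrite inE => /andP[_ /eqP].
have agV y : agree_outside (S :\ x) (Vy y).
  move=> c c' cV c'V z; rewrite !inE negb_and negbK => /orP[/eqP -> | zS].
    by rewrite !(labV y).
  exact: (agree_outside_sub (subV y) agS).
have wV y := askx y _ (subV y) (agV y) (labV y).
have [xS | xS] := boolP (x \in S).
  have [[T0 v0 m0] [T1 v1 m1]] := (wV false, wV true).
  exists (Ask x b (fun y => if y then T1 else T0)) => [|c cV] /=.
    by split=> // -[] /=.
  rewrite -leq_subRL ?f_ge //.
  have [xc | xc] := boolP (x \in c); [apply: m1 | apply: m0].
    by rewrite inE cV xc.
  by rewrite inE cV (negPf xc).
(* Here [x] was selected earlier, so nothing is asked: any member of [V] tells the label of [x] and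
   the matching case covers all of [V]. *)
have [-> | [c0 c0V]] := finset.set_0Vmem V.
  have [T vT] := sd_valid_exists S.
  by exists T => // c; rewrite inE.
have := wV (x \in c0); have -> : S :\ x = S.
  by apply/finset.setP => z; rewrite !inE; case: eqP => // ->; rewrite (negPf xS).
case=> T vT mT; exists T => // c cV.
apply: leq_trans (mT c _) (leq_subr _ _).
by rewrite inE cV; apply/eqP/agS.
Qed.

Definition first_other (s : seq X) (y : bool) c : option X :=
  ohead [seq z <- s | (z \in c) != y].

(** The scan stops at its first mistake, so it costs at most one; the rest of [s] stays available to
    the continuation, which may depend on the outcome [o]. *)
Lemma sd_within_scan (s : seq X) y S V f :
  agree_outside S V ->
  (forall o S' V', V' \subset V -> agree_outside S' V' ->
     {in V', forall c, first_other s y c = o} -> sd_within S' V' f) ->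
  sd_within S V (fun c => (f c).+1).
Proof.
elim: s S V => [|z s IH] S V agS scan.
  apply: sd_within_le (scan None S V _ _ _) => //.
apply: (sd_within_ask (x := z) (b := y)) => // [y' V' subV agV labV | c _];
  last by case: (_ != _).
have [eyy' | neyy'] := eqVneq y y'.
  have H : sd_within (S :\ z) V' (fun c => (f c).+1).
    apply: IH => // o S' V'' subV' agV' labV'.
    apply: (scan o) => // [|c cV]; first exact: fintype.subset_trans subV.
    rewrite /first_other /= (labV c) ?(fintype.subsetP subV') // eyy' eqxx /=.
    by rewrite -eyy'; apply: labV'.
  by apply: sd_within_le H => c _; rewrite subn0.
have H : sd_within (S :\ z) V' f.
  apply: (scan (Some z)) => // c cV.
  by rewrite /first_other /= (labV c cV) eq_sym neyy'.
by apply: sd_within_le H => c _; rewrite subn1.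
Qed.

(** The oracle reply that a scan of [s] reveals without knowledge of the target. *)
Definition scan_answer (s : seq X) x c : answer X :=
  (x \in c, omap (fun z => (z, x \notin c)) (first_other s (x \in c) c)).

Lemma sd_within_round (s : seq X) x S V f :
  agree_outside S V ->
  (forall q S' V', V' \subset V -> agree_outside S' V' ->
     {in V', forall c, scan_answer s x c = q} -> sd_within S' V' f) ->
  sd_within S V (fun c => (f c).+2).
Proof.
move=> agS round.
(* The prediction [true] is arbitrary: one of the two mistakes in the budget is reserved for it. *)
apply: (sd_within_ask (x := x) (b := true)) => // [y V' subV agV labV | c _];
  last by case: (_ != _).
have H : sd_within (S :\ x) V' (fun c => (f c).+1).
  apply: (sd_within_scan (s := s) (y := y)) => // o S' V'' subV' agV' labV'.
  apply: (round (y, omap (fun z => (z, ~~ y)) o)) => // [|c cV].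
    exact: fintype.subset_trans subV.
  by rewrite /scan_answer (labV c) ?labV' // (fintype.subsetP subV').
by apply: sd_within_le H => c _; case: y {labV}; rewrite ?subn0 ?subn1.
Qed.

Section Simulation.
Variables (CS : contrast_map X) (order : X -> seq X).
Variables (C : {set {set X}}) (L : learner X).

Let reply x c := scan_answer (order x) x c.

Hypothesis reply_admissible : forall x c, admissible CS c x (reply x c).

Fixpoint simulate c (h : history X) (n : nat) : history X :=
  if n is m.+1 then let h' := simulate c h m in rcons h' (L h', reply (L h') c)
  else h.

(** Once the target is fixed, the adaptive replies against [L] form a stream, as [legal_answers]
    expects. *)
Definition replies c (i : nat) : answer X :=
  reply (L (simulate c [::] i)) c.

Lemma transcript_replies c n : transcript L (replies c) n = simulate c [::] n.
Proof. by elim: n => //= n ->. Qed.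

Lemma replies_legal c : legal_answers CS L c (replies c).
Proof. by move=> i; rewrite transcript_replies; apply: reply_admissible. Qed.

Lemma simulateSr c h n :
  simulate c h n.+1 = simulate c (rcons h (L h, reply (L h) c)) n.
Proof. by elim: n => //= n <-. Qed.

Lemma version_space_rcons h x q :
  version_space CS C (rcons h (x, q))
    = [set c in version_space CS C h | admissible CS c x q].
Proof. by rewrite /version_space -cats1 foldl_cat. Qed.

(* Twice the number of rounds needed after [h], with fuel [N]; on exhaustion
   the trivial bound on the number of mistakes takes over. *)
Fixpoint mistake_bound (N : nat) (h : history X) c : nat :=
  if N is M.+1 then
    if version_space CS C h == [set c] then 0
    else (mistake_bound M (rcons h (L h, reply (L h) c)) c).+2
  else #|X|.

Lemma mistake_bound_le N h c n :
  n < N -> version_space CS C (simulate c h n) = [set c] ->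
  mistake_bound N h c <= n.*2.
Proof.
elim: N h n => // N IH h [_ /= -> | n ltnN]; first by rewrite eqxx.
rewrite simulateSr /= => eqV; case: ifP => // _.
by rewrite !ltnS; apply: IH.
Qed.

(** By induction on the fuel, one simulated round per step. Only an inclusion of [V] in the version
    space can be kept, because a scan may reveal more labels than the reply records. *)
Lemma sd_within_simulation N h S V :
  agree_outside S V -> V \subset version_space CS C h ->
  sd_within S V (mistake_bound N h).
Proof.
elim: N h S V => [|N IH] h S V agS subV; first exact: sd_within_card.
have [/cards1P[c0 eqc0] | neq1] := boolP (#|version_space CS C h| == 1).
  by apply: sd_within_le (sd_within_known S (c0 := c0) _); rewrite -?eqc0.
have H : sd_within S V
    (fun c => (mistake_bound N (rcons h (L h, reply (L h) c)) c).+2).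
  apply: (sd_within_round (s := order (L h)) (x := L h)) => //.
  move=> q S' V' subV' agV' labV'.
  have H : sd_within S' V' (mistake_bound N (rcons h (L h, q))).
    apply: IH => //; apply/fintype.subsetP => c cV.
    rewrite version_space_rcons inE (fintype.subsetP subV) ?(fintype.subsetP subV') //=.
    by rewrite -(labV' c cV) reply_admissible.
  by apply: sd_within_le H => c cV; rewrite /reply labV'.
apply: sd_within_le H => c _ /=; case: eqP => // eqc.
by rewrite eqc cards1 in neq1.
Qed.

Lemma sd_simulation :
  exists2 T, sd_valid [set: X] T &
    {in C, forall c n, version_space CS C (simulate c [::] n) = [set c] ->
       sd_mistakes T c <= n.*2}.
Proof.
(* Fuel for [#|X|] rounds suffices: if identification takes [n > #|X|] rounds, the trivial bound
   [#|X|] is already below [n.*2]. *)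
have [|//|T vT mT] :=
  @sd_within_simulation #|X|.+1 [::] [set: X] C.
  by move=> c c' _ _ x; rewrite inE.
exists T => // c cC n eqV.
have [len | gtn] := leqP n #|X|.
  exact: leq_trans (mT c cC) (mistake_bound_le _ eqV).
apply: leq_trans (sd_mistakes_le_card c vT) _.
by rewrite finset.cardsT (leq_trans (ltnW gtn)) // -addnn leq_addr.
Qed.

End Simulation.

Lemma SD_le_cost C T : sd_valid [set: X] T -> SD C <= sd_cost C T.
Proof.
rewrite /SD => vT; case: ex_minnP => m _ /(_ (sd_cost C T)); apply.
by apply/asboolP; exists T.
Qed.

Lemma SD_set1 c : SD [set c] = 0.
Proof.
have [T vT mT] := sd_within_known [set: X] (fintype.subxx [set c]).
apply/eqP; rewrite -leqn0 (leq_trans (SD_le_cost _ vT)) //.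
by rewrite /sd_cost big_set1 mT ?inE.
Qed.

(** Filtering keeps the list sorted by distance from [x], so its head is a closest point of opposite
    label; an empty list means there is no such point. *)
Lemma scan_answer_admissible (R : realType) (d : X -> X -> R) x c :
  admissible (CSmin d) c x
    (scan_answer (sort (fun a b => (d x a <= d x b)%R) (enum X)) x c).
Proof.
set le_x := fun a b => _; set s := sort le_x (enum X).
have tot : total le_x by move=> a b; apply: le_total.
have tr : transitive le_x by move=> b a e; apply: le_trans.
have mem_s z : z \in s by rewrite mem_sort mem_enum.
rewrite /admissible eqxx /= /first_other.
have: sorted le_x [seq z <- s | (z \in c) != (x \in c)].
  exact: sorted_filter tr _ _ (sort_sorted tot _).
have: forall z, (z \in [seq z <- s | (z \in c) != (x \in c)])
    = ((z \in c) != (x \in c)) by move=> z; rewrite mem_filter mem_s andbT.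
case: [seq z <- s | _] => [|z t] mem_t sorted_t /=.
  apply/eqP/finset.setP => z; rewrite !inE -mem_t; exact: andFb.
have neq_z : (z \in c) != (x \in c) by rewrite -mem_t mem_head.
rewrite !inE neq_z /=; apply/andP; split.
  apply/forallP => w; apply/implyP; rewrite -mem_t inE => /predU1P[-> //|].
  by move: (order_path_min tr sorted_t) => /allP; apply.
by move: neq_z; case: (z \in c); case: (x \in c).
Qed.

End SelfDirected.

Theorem theorem12 (R : realType) (X : finType) (C : {set {set X}})
    (d : X -> X -> R) (hC : C != finset.set0)
    (hd : forall x x' : X, (0 <= d x x')%R) :
  (((Num.ceil ((SD C)%:R / 2 : R)%R)%:~R)%:E
     <= contrast_complexity R (CSmin d) C)%E.
Proof.
rewrite /contrast_complexity; case: ifP => [/cards1P[c ->] | _].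
  by rewrite SD_set1 mul0r ceil0.
apply: le_ereal_inf_tmp => _ [L _ <-].
have admR := scan_answer_admissible d.
have [T vT mT] := sd_simulation C L admR.
(* The adversary takes a target on which [T] errs most and answers by [replies]. *)
have [|c cC costT] := @eq_bigmax_cond _ (mem C) (sd_mistakes T).
  by rewrite card_gt0.
pose a := replies (fun x => sort (fun u v => (d x u <= d x v)%R) (enum X)) L c.
apply: (@le_trans _ _ (rounds R (CSmin d) C L c a)); last first.
  apply: ereal_sup_ubound; exists (c, a) => //; split=> //=.
  exact: replies_legal.
apply: le_ereal_inf_tmp => _ [n /= eqV <-].
have le2n : SD C <= n.*2.
  rewrite (leq_trans (SD_le_cost C vT)) // /sd_cost costT mT //.
  by rewrite -transcript_replies.
(* As [n] is an integer, bounding the ceiling by [n] amounts to [SD C <= n.*2]. *)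
rewrite lee_fin -[leRHS]/((n%:Z)%:~R)%R ler_int ceil_le_int.
by rewrite ler_pdivrMr // -[(n%:~R)%R]/(n%:R)%R -natrM ler_nat muln2.
Qed.
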